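(* Let $k\in\mathbb{R}$ and let $(X,d)$ be a complete metric space of curvature $\le k$. Then $(X,d)$ is an absolute neighborhood retract.
   Context: For $k>0$ put $D_k=\pi/\sqrt{k}$; for $k\le0$ put $D_k=\infty$. $M_k^2$ is the model surface of constant curvature $k$ (rescaled sphere, Euclidean plane, or rescaled hyperbolic plane). A geodesic metric space $X$ is $\mathrm{CAT}(k)$ if every geodesic triangle in $X$ of perimeter less than $2D_k$ has a comparison triangle in $M_k^2$ (same side lengths) such that distances between points of the triangle are at most the distances between the corresponding comparison points (completeness is not part of this definition). A geodesic metric space $(X,d)$ is of curvature $\le k$ if for each $x\in X$ there is $r_x>0$ such that the ball $B(x,r_x)$, with the induced metric, is a $\mathrm{CAT}(k)$ space. A metric space $X$ is an absolute neighborhood retract (ANR) if for every embedding (homeomorphism onto its image) $h$ of $X$ into a metric space $Y$ with $h(X)$ closed in $Y$, there are an open neighborhood $U$ of $h(X)$ in $Y$ and a retraction of $U$ onto $h(X)$, i.e. a continuous map $f:U\to h(X)$ which is the identity on $h(X)$. *)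

(* Defs.v *)
From HB Require Import structures.
From mathcomp Require Import all_boot all_order all_algebra.
From mathcomp Require Import ring lra.
From mathcomp Require Import all_classical all_reals all_analysis.

Set Implicit Arguments.
Unset Strict Implicit.
Unset Printing Implicit Defensive.

Import Order.TTheory GRing.Theory Num.Theory.
Import numFieldNormedType.Exports.

Local Open Scope classical_set_scope.
Local Open Scope ring_scope.

(* The topology and the balls are those the library already puts on
   [set_type A]. *)
Section SubsetMetric.
Context {R : realType} {X : metricType R} (A : set X).

Let sub_mdist (x y : set_type A) : R := mdist (set_val x) (set_val y).

Fact sub_mdist_ge0 x y : 0 <= sub_mdist x y.
Proof. exact: mdist_ge0. Qed.

Fact sub_mdist_positivity x y : sub_mdist x y = 0 -> x = y.
Proof. by move/mdist_positivity; apply: val_inj. Qed.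

Fact sub_ballEmdist (x : set_type A) d :
  ball x d = [set y | sub_mdist x y < d].
Proof.
apply/seteqP; rewrite /sub_mdist.
by split => y /=; rewrite -[ball x d y]/(ball (set_val x) d (set_val y))
  ballEmdist.
Qed.

HB.instance Definition _ := PseudoMetric_isMetric.Build R (set_type A)
  sub_mdist_ge0 sub_mdist_positivity sub_ballEmdist.

End SubsetMetric.

(* The library's [completeType] is pointed; this allows the empty space. *)
Definition metric_complete (R : realType) (X : metricType R) : Prop :=
  forall u : nat -> X, cauchy (u @ \oo) -> exists x : X, u @ \oo --> x.

(* Only the values of [c] on the segment [0, mdist x y] matter. *)
Definition is_geodesic (R : realType) (X : metricType R)
    (x y : X) (c : R -> X) : Prop :=
  [/\ c 0 = x, c (mdist x y) = y &
      {in `[0, mdist x y] &, forall s t, mdist (c s) (c t) = `|s - t|}].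

Definition geodesic_space (R : realType) (X : metricType R) : Prop :=
  forall x y : X, exists c : R -> X, is_geodesic x y c.

Definition rescaled (R : realType) (a : {posnum R}) (X : metricType R) : Type :=
  X.

Section Rescaled.
Context {R : realType} (a : {posnum R}) (X : metricType R).

HB.instance Definition _ := Choice.on (rescaled a X).

Let rescaled_dist (x y : rescaled a X) : R :=
  a%:num * mdist (x : X) (y : X).

Fact rescaled_distxx x : rescaled_dist x x = 0.
Proof. by rewrite /rescaled_dist mdistxx mulr0. Qed.

Fact rescaled_dist_eq0 x y : rescaled_dist x y = 0 -> x = y.
Proof.
by move/eqP; rewrite mulf_eq0 gt_eqF//= => /eqP/mdist_positivity.
Qed.

Fact rescaled_dist_sym x y : rescaled_dist x y = rescaled_dist y x.
Proof. by rewrite /rescaled_dist metric_sym. Qed.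

Fact rescaled_dist_triangle y x z :
  rescaled_dist x z <= rescaled_dist x y + rescaled_dist y z.
Proof. by rewrite -mulrDr ler_pM2l// metric_triangle. Qed.

HB.instance Definition _ := isMetric.Build R (rescaled a X)
  rescaled_distxx rescaled_dist_eq0 rescaled_dist_sym rescaled_dist_triangle.

End Rescaled.

Definition dot (R : realType) n (u v : 'rV[R]_n) : R :=
  \sum_(i < n) u 0 i * v 0 i.

Section Dot.
Context {R : realType}.

Fact dotC n (u v : 'rV[R]_n) : dot u v = dot v u.
Proof. by apply: eq_bigr => i _; rewrite mulrC. Qed.

Fact dot_ge0 n (u : 'rV[R]_n) : 0 <= dot u u.
Proof. by apply: sumr_ge0 => i _; rewrite -expr2 sqr_ge0. Qed.

Fact dot_eq0 n (u : 'rV[R]_n) : dot u u = 0 -> u = 0.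
Proof.
move/psumr_eq0P => u0; apply/rowP => i; rewrite mxE; apply/eqP.
by rewrite -sqrf_eq0 expr2 u0// => j _; rewrite -expr2 sqr_ge0.
Qed.

Fact dotBB n (u v : 'rV[R]_n) :
  dot (u - v) (u - v) = dot u u - 2 * dot u v + dot v v.
Proof.
rewrite /dot mulr_sumr -sumrB -big_split; apply: eq_bigr => i _ /=.
rewrite !mxE; ring.
Qed.

Fact dotE2 (u v : 'rV[R]_2) :
  dot u v = u 0 0 * v 0 0 + u 0 1 * v 0 1.
Proof.
rewrite /dot !big_ord_recl big_ord0 addr0.
by congr (u _ _ * v _ _ + u _ _ * v _ _); apply/val_inj.
Qed.

Fact dotE3 (u v : 'rV[R]_3) :
  dot u v = u 0 0 * v 0 0 + u 0 1 * v 0 1 + u 0 2 * v 0 2.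
Proof.
rewrite /dot !big_ord_recl big_ord0 addr0 addrA.
by congr (u _ _ * v _ _ + u _ _ * v _ _ + u _ _ * v _ _); apply/val_inj.
Qed.

End Dot.

(* [M_0^2]; an alias because the library metrizes ['rV[R]_2] by the sup norm. *)
Definition euclidean_plane (R : realType) : Type := 'rV[R]_2.

Section EuclideanPlane.
Context {R : realType}.

HB.instance Definition _ := Choice.on (euclidean_plane R).

Let euclidean_dist (u v : euclidean_plane R) : R :=
  Num.sqrt (dot (u - v : 'rV[R]_2) (u - v : 'rV[R]_2)).

Fact euclidean_distxx u : euclidean_dist u u = 0.
Proof.
by rewrite /euclidean_dist subrr dotE2 !mxE !mul0r addr0 sqrtr0.
Qed.

Fact euclidean_dist_eq0 u v : euclidean_dist u v = 0 -> u = v.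
Proof.
move/eqP; rewrite sqrtr_eq0 => uv; apply/eqP; rewrite -subr_eq0; apply/eqP.
by apply: dot_eq0; apply/eqP; rewrite eq_le uv dot_ge0.
Qed.

Fact euclidean_dist_sym u v : euclidean_dist u v = euclidean_dist v u.
Proof.
by rewrite /euclidean_dist !dotBB (dotC u v); congr Num.sqrt; ring.
Qed.

Fact euclidean_dist_triangle v u w :
  euclidean_dist u w <= euclidean_dist u v + euclidean_dist v w.
Proof.
rewrite /euclidean_dist !dotE2 !mxE.
move: (u 0 0) (u 0 1) (v 0 0) (v 0 1) (w 0 0) (w 0 1) => a b c d e f.
set p := _ + _; set q := (c - e) * _ + _.
set r := (a - c) * _ + _.
have q0 : 0 <= q by rewrite /q -!expr2 addr_ge0 ?sqr_ge0.
have r0 : 0 <= r by rewrite /r -!expr2 addr_ge0 ?sqr_ge0.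
rewrite -[leRHS]ger0_norm ?addr_ge0 ?sqrtr_ge0// -sqrtr_sqr.
rewrite ler_wsqrtr// sqrrD !sqr_sqrtr//.
suff : (a - c) * (c - e) + (b - d) * (d - f) <= Num.sqrt r * Num.sqrt q.
  by move=> h; rewrite mulr2n /p /r /q; lra.
rewrite -sqrtrM// (le_trans (ler_norm _))// -sqrtr_sqr ler_wsqrtr//.
rewrite -subr_ge0.
rewrite (_ : _ - _ = ((a - c) * (d - f) - (b - d) * (c - e)) ^+ 2) ?sqr_ge0//.
by rewrite /r /q; ring.
Qed.

HB.instance Definition _ := isMetric.Build R (euclidean_plane R)
  euclidean_distxx euclidean_dist_eq0 euclidean_dist_sym
  euclidean_dist_triangle.

End EuclideanPlane.

(* [M_1^2], with its angular metric. *)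
Record sphere (R : realType) := Sphere {
  sphere_val :> 'rV[R]_3;
  sphereP : dot sphere_val sphere_val == 1 }.

Section SphereMetric.
Context {R : realType}.

HB.instance Definition _ := [isSub for @sphere_val R].
HB.instance Definition _ := [Choice of sphere R by <:].

Let sphere_dist (u v : sphere R) : R := acos (dot u v).

Fact sphere_dot_itv (u v : sphere R) : -1 <= dot u v <= 1.
Proof.
have /eqP u1 := sphereP u; have /eqP v1 := sphereP v.
have := dot_ge0 (sphere_val u - sphere_val v).
have := dot_ge0 (sphere_val u - - sphere_val v).
have NE (x y : 'rV[R]_3) : dot x (- y) = - dot x y.
  by rewrite /dot -sumrN; apply: eq_bigr => i _; rewrite mxE mulrN.
have NN (x : 'rV[R]_3) : dot (- x) (- x) = dot x x.
  by apply: eq_bigr => i _; rewrite mxE mulrNN.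
by rewrite !dotBB NN NE u1 v1; lra.
Qed.

Fact sphere_distxx u : sphere_dist u u = 0.
Proof. by rewrite /sphere_dist (eqP (sphereP u)) acos1. Qed.

Fact sphere_dist_eq0 u v : sphere_dist u v = 0 -> u = v.
Proof.
move=> uv0; have uv1 : dot u v = 1.
  by rewrite -[LHS]acosK ?in_itv/= ?sphere_dot_itv// -/(sphere_dist u v) uv0 cos0.
apply/val_inj => /=; apply/eqP; rewrite -subr_eq0; apply/eqP/dot_eq0.
rewrite dotBB uv1 (eqP (sphereP u)) (eqP (sphereP v)); lra.
Qed.

Fact sphere_dist_sym u v : sphere_dist u v = sphere_dist v u.
Proof. by rewrite /sphere_dist dotC. Qed.

Fact sphere_gram (u v w : sphere R) :
  (dot u w - dot u v * dot v w) ^+ 2 <=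
  (1 - dot u v ^+ 2) * (1 - dot v w ^+ 2).
Proof.
have /eqP u1 := sphereP u; have /eqP v1 := sphereP v.
have /eqP w1 := sphereP w; rewrite -subr_ge0.
have -> : (1 - dot u v ^+ 2) * (1 - dot v w ^+ 2) -
    (dot u w - dot u v * dot v w) ^+ 2 =
  dot u u * dot v v * dot w w + 2 * dot u v * dot v w * dot u w
  - dot u u * dot v w ^+ 2 - dot v v * dot u w ^+ 2 - dot w w * dot u v ^+ 2.
  by rewrite u1 v1 w1; ring.
rewrite !dotE3; set d := (X in 0 <= X).
have -> : d = (u 0 0 * (v 0 1 * w 0 2 - v 0 2 * w 0 1)
  - u 0 1 * (v 0 0 * w 0 2 - v 0 2 * w 0 0)
  + u 0 2 * (v 0 0 * w 0 1 - v 0 1 * w 0 0)) ^+ 2.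
  by rewrite /d; ring.
exact: sqr_ge0.
Qed.

Fact sphere_dist_triangle v u w :
  sphere_dist u w <= sphere_dist u v + sphere_dist v w.
Proof.
have uv := sphere_dot_itv u v; have vw := sphere_dot_itv v w.
have uw := sphere_dot_itv u w; rewrite /sphere_dist.
have [piuv|uvpi] := leP pi (acos (dot u v) + acos (dot v w)).
  by rewrite (le_trans _ piuv)// acos_lepi.
have A0 := acos_ge0 uv; have B0 := acos_ge0 vw.
rewrite leNgt -ltr_cos ?in_itv/= ?acos_ge0 ?acos_lepi ?addr_ge0 ?(ltW uvpi)//.
rewrite -leNgt cosD !sin_acos// !acosK ?in_itv//=.
rewrite -sqrtrM; last by rewrite subr_ge0; nra.
rewrite lerBlDr -lerBlDl (le_trans (ler_norm _))// -sqrtr_sqr ler_wsqrtr//.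
by rewrite -sqrrN opprB sphere_gram.
Qed.

HB.instance Definition _ := isMetric.Build R (sphere R)
  sphere_distxx sphere_dist_eq0 sphere_dist_sym sphere_dist_triangle.

End SphereMetric.

Definition acosh (R : realType) (x : R) : R := ln (x + Num.sqrt (x ^+ 2 - 1)).

(* The Lorentz form, the timelike coordinate being the one of index 0. *)
Definition lorentz (R : realType) (u v : 'rV[R]_3) : R :=
  u 0 1 * v 0 1 + u 0 2 * v 0 2 - u 0 0 * v 0 0.

(* [M_{-1}^2]: the upper sheet of the hyperboloid. *)
Record hyperboloid (R : realType) := Hyperboloid {
  hyperboloid_val :> 'rV[R]_3;
  hyperboloidP : (lorentz hyperboloid_val hyperboloid_val == -1) &&
                 (0 < hyperboloid_val 0 0) }.

Section HyperboloidMetric.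
Context {R : realType}.

HB.instance Definition _ := [isSub for @hyperboloid_val R].
HB.instance Definition _ := [Choice of hyperboloid R by <:].

Let hyperbolic_dist (u v : hyperboloid R) : R := acosh (- lorentz u v).

Fact lorentzC (u v : 'rV[R]_3) : lorentz u v = lorentz v u.
Proof. by rewrite /lorentz; ring. Qed.

Fact lorentz_le (u v : hyperboloid R) : 1 <= - lorentz u v.
Proof.
case: u v => [u /= /andP[/eqP u1 u0]] [v /= /andP[/eqP v1 v0]].
move: u1 v1; rewrite /lorentz.
move: (u 0 0) (u 0 1) (u 0 2) (v 0 0) (v 0 1) (v 0 2) u0 v0.
move=> a b c d e f a0 d0 u1 v1.
rewrite opprB lerBrDr.
have ad0 : 0 <= a * d by rewrite mulr_ge0 ?ltW.
rewrite (le_trans (ler_norm _))// -[leRHS]ger0_norm// -!sqrtr_sqr ler_wsqrtr//.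
have -> : (a * d) ^+ 2 = (1 + (b * b + c * c)) * (1 + (e * e + f * f)).
  have -> : 1 + (b * b + c * c) = a * a by lra.
  have -> : 1 + (e * e + f * f) = d * d by lra.
  ring.
have h1 := sqr_ge0 (b * f - c * e); have h2 := sqr_ge0 (b - e).
have h3 := sqr_ge0 (c - f); nra.
Qed.

Fact hyperbolic_distxx u : hyperbolic_dist u u = 0.
Proof.
rewrite /hyperbolic_dist; case: u => u /= /andP[/eqP-> _].
by rewrite /acosh opprK expr1n subrr sqrtr0 addr0 ln1.
Qed.

Fact hyperbolic_dist_eq0 u v : hyperbolic_dist u v = 0 -> u = v.
Proof.
have := lorentz_le u v; rewrite /hyperbolic_dist /acosh.
set x := - _ => x1 ln0.
have s0 := sqrtr_ge0 (x ^+ 2 - 1).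
have {ln0} : x + Num.sqrt (x ^+ 2 - 1) = 1.
  by apply: ln_inj; rewrite ?posrE ?ln1//; lra.
move=> x1'; have {s0 x1 x1'} : x = 1 by lra.
rewrite {}/x; case: u v => [u uP] [v vP] /= uv; apply/val_inj => /=.
case/andP: uP vP => /eqP u1 u0 /andP[/eqP v1 v0].
suff [e0 e1 e2] : [/\ u 0 0 = v 0 0, u 0 1 = v 0 1 & u 0 2 = v 0 2].
  apply/rowP => -[[|[|[|//]]] i].
  - by rewrite (_ : Ordinal i = 0)//; apply/val_inj.
  - by rewrite (_ : Ordinal i = 1)//; apply/val_inj.
  - by rewrite (_ : Ordinal i = 2)//; apply/val_inj.
move: uv u1 v1; rewrite /lorentz.
move: (u 0 0) (u 0 1) (u 0 2) (v 0 0) (v 0 1) (v 0 2) u0 v0.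
move=> a b c d e f a0 d0 uv u1 v1.
have ad : a * d = 1 + b * e + c * f by lra.
(* (ad)^2 = (1 + b^2 + c^2)(1 + e^2 + f^2): equality in Cauchy-Schwarz *)
have h : (a * d) ^+ 2 = (1 + (b * b + c * c)) * (1 + (e * e + f * f)).
  have -> : 1 + (b * b + c * c) = a * a by lra.
  have -> : 1 + (e * e + f * f) = d * d by lra.
  ring.
have {h} h : (b - e) ^+ 2 + (c - f) ^+ 2 + (b * f - c * e) ^+ 2 = 0.
  by rewrite ad in h; move: h; lra.
have h1 := sqr_ge0 (b * f - c * e); have h2 := sqr_ge0 (b - e).
have h3 := sqr_ge0 (c - f).
have /eqP : (b - e) ^+ 2 = 0 by lra.
have /eqP : (c - f) ^+ 2 = 0 by lra.
rewrite !sqrf_eq0 !subr_eq0 => /eqP cf /eqP be; split=> //.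
apply/eqP; rewrite -(@eqrXn2 _ 2)// ?ltW//; apply/eqP; subst; lra.
Qed.

Fact hyperbolic_dist_sym u v : hyperbolic_dist u v = hyperbolic_dist v u.
Proof. by rewrite /hyperbolic_dist lorentzC. Qed.

Fact lorentz_gram (u v w : hyperboloid R) :
  (lorentz u w + lorentz u v * lorentz v w) ^+ 2 <=
  (lorentz u v ^+ 2 - 1) * (lorentz v w ^+ 2 - 1).
Proof.
case: u v w => [u /= /andP[/eqP u1 _]] [v /= /andP[/eqP v1 _]]
  [w /= /andP[/eqP w1 _]].
rewrite -subr_ge0.
have -> : (lorentz u v ^+ 2 - 1) * (lorentz v w ^+ 2 - 1) -
    (lorentz u w + lorentz u v * lorentz v w) ^+ 2 =
  - (lorentz u u * lorentz v v * lorentz w w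
  + 2 * lorentz u v * lorentz v w * lorentz u w
  - lorentz u u * lorentz v w ^+ 2 - lorentz v v * lorentz u w ^+ 2
  - lorentz w w * lorentz u v ^+ 2).
  by rewrite u1 v1 w1; ring.
set d := (X in 0 <= X).
have -> : d = (u 0 0 * (v 0 1 * w 0 2 - v 0 2 * w 0 1)
  - u 0 1 * (v 0 0 * w 0 2 - v 0 2 * w 0 0)
  + u 0 2 * (v 0 0 * w 0 1 - v 0 1 * w 0 0)) ^+ 2.
  by rewrite /d /lorentz; ring.
exact: sqr_ge0.
Qed.

Fact hyperbolic_dist_triangle v u w :
  hyperbolic_dist u w <= hyperbolic_dist u v + hyperbolic_dist v w.
Proof.
have := lorentz_gram u v w; rewrite /hyperbolic_dist /acosh.
move: (lorentz_le u v) (lorentz_le v w) (lorentz_le u w).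
rewrite -[lorentz u v]opprK -[lorentz v w]opprK -[lorentz u w]opprK.
move: (- lorentz u v) (- lorentz v w) (- lorentz u w) => a b c a1 b1 c1 h.
rewrite !opprK; move: h; rewrite !sqrrN mulrNN => h.
have a2 : 0 <= a ^+ 2 - 1 by nra.
have b2 : 0 <= b ^+ 2 - 1 by nra.
have c2 : 0 <= c ^+ 2 - 1 by nra.
set p := Num.sqrt (a ^+ 2 - 1); set q := Num.sqrt (b ^+ 2 - 1).
have p0 : 0 <= p by exact: sqrtr_ge0.
have q0 : 0 <= q by exact: sqrtr_ge0.
have pE : p ^+ 2 = a ^+ 2 - 1 by rewrite sqr_sqrtr.
have qE : q ^+ 2 = b ^+ 2 - 1 by rewrite sqr_sqrtr.
have ab0 : 0 <= a * b by nra.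
have pq0 : 0 <= p * q by rewrite mulr_ge0.
have aq0 : 0 <= a * q by rewrite mulr_ge0//; lra.
have bp0 : 0 <= b * p by rewrite mulr_ge0//; lra.
have cab : c <= a * b + p * q.
  rewrite addrC -lerBlDr (le_trans (ler_norm _))//.
  rewrite -[leRHS]ger0_norm// -!sqrtr_sqr ler_wsqrtr//.
  by rewrite exprMn pE qE (le_trans _ h)// -[leRHS]sqrrN opprD opprK.
rewrite -lnM ?posrE; [|lra|lra].
rewrite ler_ln ?posrE; [|have := sqrtr_ge0 (c ^+ 2 - 1); lra|]; last first.
  by rewrite mulr_gt0//; lra.
suff : Num.sqrt (c ^+ 2 - 1) <= a * q + b * p by rewrite mulrDl !mulrDr; lra.
rewrite -[leRHS]ger0_norm ?addr_ge0// -sqrtr_sqr ler_wsqrtr//.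
have -> : (a * q + b * p) ^+ 2 = (a * b + p * q) ^+ 2 - 1.
  rewrite !sqrrD !exprMn pE qE; ring.
by rewrite lerD2r lerXn2r// ?nnegrE; lra.
Qed.

HB.instance Definition _ := isMetric.Build R (hyperboloid R)
  hyperbolic_distxx hyperbolic_dist_eq0 hyperbolic_dist_sym
  hyperbolic_dist_triangle.

End HyperboloidMetric.

Fact model_scale_gt0 (R : realType) (k : R) :
  k != 0 -> 0 < (Num.sqrt `|k|)^-1.
Proof. by move=> k0; rewrite invr_gt0 sqrtr_gt0 normr_gt0. Qed.

Definition model_scale (R : realType) (k : R) (k0 : k != 0) : {posnum R} :=
  PosNum (model_scale_gt0 k0).

(* [M_k^2]: curvature [k] is obtained by scaling the metrics of curvature
   [1] and [-1] by [1 / sqrt |k|]. *)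
Definition model_surface (R : realType) (k : R) : metricType R :=
  match eqVneq k 0 with
  | EqNotNeq _ => euclidean_plane R
  | NeqNotEq k0 =>
      if 0 < k then rescaled (model_scale k0) (sphere R) : metricType R
      else rescaled (model_scale k0) (hyperboloid R) : metricType R
  end.

(* [D_k]. *)
Definition model_diam (R : realType) (k : R) : \bar R :=
  if 0 < k then (pi / Num.sqrt k)%:E else +oo%E.

(* The side of index [i] is a geodesic segment [c i] from the vertex [v i] to
   the next vertex [v (i + 1)], the addition in ['I_3] being modulo 3. *)
Definition geodesic_triangle (R : realType) (X : metricType R)
    (v : 'I_3 -> X) (c : 'I_3 -> R -> X) : Prop :=
  forall i, is_geodesic (v i) (v (i + 1)) (c i).

Definition side_length (R : realType) (X : metricType R) (v : 'I_3 -> X)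
  (i : 'I_3) : R := mdist (v i) (v (i + 1)).

Definition perimeter (R : realType) (X : metricType R) (v : 'I_3 -> X) : R :=
  \sum_i side_length v i.

(* The comparison point of [c i s] is [c' i s], which lies on the corresponding
   side at the same distance [s] from its initial vertex. *)
Definition CAT (R : realType) (k : R) (X : metricType R) : Prop :=
  geodesic_space X /\
  forall (v : 'I_3 -> X) (c : 'I_3 -> R -> X),
    geodesic_triangle v c ->
    ((perimeter v)%:E < 2%:E * model_diam k)%E ->
    exists (v' : 'I_3 -> model_surface k) (c' : 'I_3 -> R -> model_surface k),
      [/\ geodesic_triangle v' c',
          forall i, side_length v' i = side_length v i &
          forall i j s t,
            s \in `[0, side_length v i] -> t \in `[0, side_length v j] ->
            mdist (c i s) (c j t) <= mdist (c' i s) (c' j t)].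

Definition curvature_le (R : realType) (k : R) (X : metricType R) : Prop :=
  geodesic_space X /\
  forall x : X, exists2 r : R, 0 < r & CAT k (set_type (ball x r)).

(* [g] is the inverse of [h], defined on the subspace [range h]. *)
Definition embedding (T U : topologicalType) (h : T -> U) : Prop :=
  [/\ injective h, continuous h &
      exists2 g : set_type (range h) -> T,
        continuous g & forall y, h (g y) = set_val y].

(* The retraction [f] is a function on [U]; its values outside [U] are junk. *)
Definition absolute_neighborhood_retract (R : realType) (X : metricType R) :
    Prop :=
  forall (Y : metricType R) (h : X -> Y),
    embedding h -> closed (range h) ->
    exists (U : set Y) (f : Y -> Y),
      [/\ open U, range h `<=` U, {within U, continuous f},
          f @` U `<=` range h & forall y, range h y -> f y = y].

(* Main.v *)
Require Import Defs.
From mathcomp Require Import all_boot all_order all_algebra.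
From mathcomp Require Import ring lra.
From mathcomp Require Import all_classical all_reals all_analysis.

Set Implicit Arguments.
Unset Strict Implicit.
Unset Printing Implicit Defensive.

Import Order.TTheory GRing.Theory Num.Theory.
Import numFieldNormedType.Exports.

Local Open Scope classical_set_scope.
Local Open Scope ring_scope.

(** Let A be a closed copy of X in a metric space Y, and let y be a point of Y
    off A.  The retraction sends y to a weighted circumcentre, in X, of the part
    of A that is nearest to y.  The weight of p in X is 1 when the distance from
    y to the image of p is at most twice the distance [gap y] from y to A, and 0
    when it is more than three times that distance.  The point associated with y
    is the limit of the points x that nearly minimize
      cost y x = sup over p of G (d (x, p)) + 2 * weight y p,
    where G is a fixed function which makes each G (d (., p)) uniformly convex
    along midpoints, locally in X.

    A supremum of uniformly convex functions is uniformly convex with the same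
    modulus, so two points at which [cost y] is almost minimal are close to each
    other ([near_min_close]); as X is complete, near-minimizers converge to one
    point, the centre ([center_exists], [center_unique]).  The weights depend on
    y in a Lipschitz way, uniformly in p, so the functions [cost y] and
    [cost y'] are uniformly close when y and y' are, and a near-minimizer of one
    is a near-minimizer of the other: the centre depends continuously on y
    ([center_continuous]).  When y tends to the image of x0, every p of positive
    weight tends to x0, and so does the centre ([center_near]).  The
    supremum of weighted convex functions plays the part of the average over a
    partition of unity in Dugundji's extension theorem.

    The local convexity comes from the model surfaces.  In the Euclidean plane,
    the sphere and the hyperbolic plane the functions t^2, 1 - cos t and
    cosh t - 1 of the distance to a point are related to the coordinates of an
    ambient linear space in which the midpoint of x and z is proportional to
    x + z; their values at a midpoint are therefore computed exactly from the
    values at the ends ([model_surface_midpoint_convex]).  The comparison of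
    triangles with one vertex at p and a midpoint on the opposite side transfers
    the inequality to small balls of X ([CAT_midpoint],
    [curvature_le_uniformly_convex]). *)

(** * Convexity of distances in the model surfaces *)

(** [g] is the function to be composed with distances and [w] its modulus of
    convexity.  Monotonicity is required up to [2 * T] because the midpoint of a
    side of length at most [T] may be farther than [T] from a vertex that is
    within [T] of both ends. *)
Record gauge (R : realType) (g w : R -> R) (T : R) : Prop := Gauge {
  gauge_pos : 0 < T;
  gauge_mono : forall s t, 0 <= s -> s < t -> t <= 2 * T -> g s < g t;
  gauge_ge0 : 0 <= g 0;
  gauge_le1 : g T <= 1;
  modulus_mono : forall s t, 0 <= s -> s <= t -> t <= T -> w s <= w t;
  modulus_gt0 : forall t, 0 < t -> t <= T -> 0 < w t }.

Definition midpoint_convex (R : realType) (X : metricType R) (g w : R -> R)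
    (T : R) : Prop :=
  forall x z m p : X,
    mdist x m = mdist x z / 2 -> mdist z m = mdist x z / 2 ->
    mdist x z <= T -> mdist x p <= T -> mdist z p <= T ->
    g (mdist m p) <= (g (mdist x p) + g (mdist z p)) / 2 - w (mdist x z).

Lemma gauge_scale (R : realType) (g w : R -> R) (T q : R) :
  0 < q -> gauge g w T ->
  gauge (fun t => g (q^-1 * t)) (fun t => w (q^-1 * t)) (q * T).
Proof.
move=> q0 [T0 gm g0 g1 wm w0].
have iq0 : 0 < q^-1 by rewrite invr_gt0.
have qK t : q * (q^-1 * t) = t by rewrite mulrA mulfV ?gt_eqF// mul1r.
have qT t s : (q^-1 * t <= s) = (t <= q * s) by rewrite -(ler_pM2l q0) qK.
split; first exact: mulr_gt0.
- move=> s t s0 st tT; apply: gm; rewrite ?mulr_ge0 ?ltr_pM2l ?(ltW iq0)//.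
  by rewrite qT mulrCA.
- by rewrite mulr0.
- by rewrite mulrA mulVf ?gt_eqF// mul1r.
- move=> s t s0 st tT; apply: wm; rewrite ?mulr_ge0 ?ler_pM2l ?(ltW iq0)//.
  by rewrite qT.
- by move=> t t0 tT; apply: w0; rewrite ?mulr_gt0// qT.
Qed.

Lemma midpoint_convex_scale (R : realType) (X : metricType R) (g w : R -> R)
    (T : R) (q : {posnum R}) :
  midpoint_convex X g w T ->
  midpoint_convex (rescaled q X) (fun t => g (q%:num^-1 * t))
    (fun t => w (q%:num^-1 * t)) (q%:num * T).
Proof.
move=> cX x z m p.
have E (u v : rescaled q X) : mdist u v = q%:num * mdist (u : X) (v : X) by [].
rewrite !E !(mulrA (_^-1)) mulVf ?gt_eqF// !mul1r -mulrA !ler_pM2l//.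
by move=> /mulfI xm /mulfI zm; apply: cX; [apply: xm|apply: zm]; rewrite gt_eqF.
Qed.

Lemma euclidean_gauge (R : realType) :
  gauge (fun t : R => t ^+ 2) (fun t => t ^+ 2 / 4) 1.
Proof.
split; rewrite ?ltr01 ?expr0n ?expr1n//=.
- by move=> s t s0 st _; rewrite ltrXn2r// ?nnegrE ?(le_trans s0 (ltW st)).
- move=> s t s0 st _; rewrite ler_pM2r ?invr_gt0//.
  by rewrite lerXn2r// ?nnegrE ?(le_trans s0 st).
- by move=> t t0 _; rewrite divr_gt0// exprn_gt0.
Qed.

(** The parallelogram law, with equality. *)
Lemma euclidean_midpoint_convex (R : realType) T :
  midpoint_convex (euclidean_plane R) (fun t => t ^+ 2) (fun t => t ^+ 2 / 4) T.
Proof.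
move=> x z m p xm zm _ _ _.
have E (u v : euclidean_plane R) : mdist u v ^+ 2 =
    (u 0 0 - v 0 0) ^+ 2 + (u 0 1 - v 0 1) ^+ 2.
  rewrite -[mdist u v]/(Num.sqrt (dot (u - v : 'rV[R]_2) (u - v : 'rV[R]_2))).
  by rewrite sqr_sqrtr ?dot_ge0// dotE2 !mxE -!expr2.
have {}xm : 4 * mdist x m ^+ 2 = mdist x z ^+ 2 by rewrite xm; field.
have {}zm : 4 * mdist z m ^+ 2 = mdist x z ^+ 2 by rewrite zm; field.
move: xm zm; rewrite !E.
move: (x 0 0) (x 0 1) (z 0 0) (z 0 1) (m 0 0) (m 0 1) (p 0 0) (p 0 1).
move=> x0 x1 z0 z1 m0 m1 p0 p1 xm zm.
(* a point at half the distance from both ends is (x + z) / 2 *)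
have mE : (2 * m0 - x0 - z0) ^+ 2 + (2 * m1 - x1 - z1) ^+ 2 = 0 by lra.
have h0 := sqr_ge0 (2 * m0 - x0 - z0); have h1 := sqr_ge0 (2 * m1 - x1 - z1).
have /eqP : (2 * m0 - x0 - z0) ^+ 2 = 0 by lra.
have /eqP : (2 * m1 - x1 - z1) ^+ 2 = 0 by lra.
rewrite !sqrf_eq0 => /eqP e1 /eqP e0.
have -> : m0 = (x0 + z0) / 2 by lra.
have -> : m1 = (x1 + z1) / 2 by lra.
lra.
Qed.

Lemma ler_cos (R : realType) :
  {in `[0, pi] &, {mono (@cos R) : x y /~ y <= x}}.
Proof. by move=> x y xI yI; rewrite !leNgt ltr_cos. Qed.

Lemma acos_half_le (R : realType) : acos (2^-1 : R) <= pi / 2.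
Proof.
have h : -1 <= (2^-1 : R) <= 1 by lra.
have p0 := pi_gt0 R.
rewrite -ler_cos ?in_itv/= ?acos_ge0 ?acos_lepi//; last by lra.
by rewrite acosK ?in_itv// cos_pihalf invr_ge0.
Qed.

Lemma sphere_gauge (R : realType) :
  gauge (fun t : R => 1 - cos t) (fun t => (1 - cos (t / 2)) / 2)
    (acos (2^-1 : R)).
Proof.
have h : -1 <= (2^-1 : R) <= 1 by lra.
have p0 := pi_gt0 R; have ph := acos_half_le R.
split.
- rewrite lt_neqAle acos_ge0// andbT; apply/eqP => e.
  have := acosK (x := 2^-1 : R); rewrite in_itv /= -e cos0 => /(_ h); lra.
- move=> s t s0 st tT; rewrite ltrD2l ltrN2 ltr_cos// ?in_itv/=; lra.
- by rewrite cos0 subrr.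
- rewrite acosK ?in_itv//; lra.
- move=> s t s0 st tT; rewrite ler_pM2r ?invr_gt0// lerD2l lerN2.
  by rewrite ler_cos ?in_itv/=; lra.
- move=> t t0 tT; rewrite divr_gt0// subr_gt0 -[ltRHS]cos0.
  by rewrite ltr_cos ?in_itv/=; lra.
Qed.

(** With c the cosine of half the side, the identity x + z = 2 c m gives
    [dot m p = (dot x p + dot z p) / (2 * c)].  Dividing by c < 1 increases a
    positive quantity, and the radius [acos 2^-1] keeps the scalar products above
    1/2, which makes the gain at least [(1 - c) / 2]. *)
Lemma sphere_midpoint_convex (R : realType) :
  midpoint_convex (sphere R) (fun t => 1 - cos t)
    (fun t => (1 - cos (t / 2)) / 2) (acos 2^-1).
Proof.
move=> x z m p.
have h : -1 <= (2^-1 : R) <= 1 by lra.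
have p0 := pi_gt0 R; have ph := acos_half_le R.
have E (u v : sphere R) : cos (mdist u v) = dot u v.
  by rewrite -[mdist u v]/(acos (dot u v)) acosK ?in_itv//= sphere_dot_itv.
have B (u v : sphere R) : mdist u v <= acos 2^-1 -> 2^-1 <= dot u v.
  move=> uvT; rewrite -E -[leLHS](acosK (x := 2^-1 : R)) ?in_itv//.
  have := mdist_ge0 u v.
  by rewrite ler_cos ?in_itv/= ?mdist_ge0 ?acos_ge0//; lra.
set D := mdist x z => xm zm DT xp zp.
have D0 : 0 <= D by exact: mdist_ge0.
set c := cos (D / 2).
have c1 : c <= 1 by exact: cos_le1.
have c0 : 0 < c by apply: cos_gt0_pihalf; lra.
have xzE : dot x z = 2 * c ^+ 2 - 1.
  rewrite -E -/D (_ : D = (D / 2) *+ 2) ?cos_mulr2n ?mulr_natl//.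
  by rewrite mulr2n; lra.
have {}xm : dot x m = c by rewrite -E xm.
have {}zm : dot z m = c by rewrite -E zm.
move: (B _ _ xp) (B _ _ zp); rewrite !E => {B E} xp2 zp2.
have /eqP xx := sphereP x; have /eqP zz := sphereP z; have /eqP mm := sphereP m.
(* the norm of x + z - 2 c m vanishes *)
have mE : dot x p + dot z p = 2 * c * dot m p.
  have : (x 0 0 + z 0 0 - 2 * c * m 0 0) ^+ 2 +
         (x 0 1 + z 0 1 - 2 * c * m 0 1) ^+ 2 +
         (x 0 2 + z 0 2 - 2 * c * m 0 2) ^+ 2 = 0.
    transitivity (dot x x + dot z z + 4 * c ^+ 2 * dot m m + 2 * dot x z -
        4 * c * dot x m - 4 * c * dot z m); first by rewrite !dotE3; ring.
    by rewrite xx zz mm xm zm xzE; ring.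
  rewrite !dotE3; have h0 := sqr_ge0 (x 0 0 + z 0 0 - 2 * c * m 0 0).
  have h1 := sqr_ge0 (x 0 1 + z 0 1 - 2 * c * m 0 1).
  have h2 := sqr_ge0 (x 0 2 + z 0 2 - 2 * c * m 0 2) => s0.
  have /eqP : (x 0 0 + z 0 0 - 2 * c * m 0 0) ^+ 2 = 0 by lra.
  have /eqP : (x 0 1 + z 0 1 - 2 * c * m 0 1) ^+ 2 = 0 by lra.
  have /eqP : (x 0 2 + z 0 2 - 2 * c * m 0 2) ^+ 2 = 0 by lra.
  rewrite !sqrf_eq0 !subr_eq0 !(eq_sym _ (2 * c * _)) !mulrDr.
  by rewrite !(mulrA (2 * c)) => /eqP-> /eqP-> /eqP->; ring.
have mp : 2^-1 <= dot m p.
  rewrite leNgt; apply/negP => mp; have : c * dot m p < c * 2^-1.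
    by rewrite ltr_pM2l.
  by lra.
have := mulr_ge0 (_ : 0 <= 1 - c) (_ : 0 <= dot m p - 2^-1).
rewrite !subr_ge0 => /(_ c1 mp); lra.
Qed.

Definition cosh (R : realType) (t : R) : R := (expR t + expR (- t)) / 2.

Section Cosh.
Context {R : realType}.
Implicit Types t : R.

Lemma cosh0 : cosh 0 = 1 :> R.
Proof. by rewrite /cosh oppr0 expR0; field. Qed.

Lemma ltr_cosh s t : 0 <= s -> s < t -> cosh s < cosh t.
Proof.
move=> s0 st; rewrite /cosh ltr_pM2r ?invr_gt0// !expRN -subr_gt0.
have es : 1 <= expR s by rewrite -expR0 ler_expR.
have et : 1 < expR t by rewrite -expR0 ltr_expR (le_lt_trans s0).
have est : expR s < expR t by rewrite ltr_expR.
rewrite (_ : _ - _ =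
  (expR t - expR s) * (1 - (expR s * expR t)^-1)); last first.
  by field; rewrite !gt_eqF ?expR_gt0.
rewrite mulr_gt0 ?subr_gt0// invf_lt1; first by nra.
by rewrite mulr_gt0 ?expR_gt0.
Qed.

Lemma ler_cosh s t : 0 <= s -> s <= t -> cosh s <= cosh t.
Proof.
by move=> s0; rewrite le_eqVlt => /predU1P[->//|st]; exact/ltW/ltr_cosh.
Qed.

Lemma cosh_ge1 t : 0 <= t -> 1 <= cosh t.
Proof. by move=> t0; rewrite -cosh0 ler_cosh. Qed.

Lemma cosh_double t : cosh t = 2 * cosh (t / 2) ^+ 2 - 1.
Proof.
rewrite /cosh {1 2}(splitr t) opprD !expRD !expRN.
by field; rewrite gt_eqF ?expR_gt0.
Qed.

Lemma acoshK (c : R) : 1 <= c -> cosh (acosh c) = c.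
Proof.
move=> c1; have c2 : 0 <= c ^+ 2 - 1 by nra.
have s0 := sqrtr_ge0 (c ^+ 2 - 1); have sE := sqr_sqrtr c2.
rewrite /cosh expRN /acosh lnK ?posrE; last by lra.
move: s0 sE; set s := Num.sqrt _ => s0 sE.
suff -> : (c + s)^-1 = c - s by field.
have cs : c + s != 0 by rewrite gt_eqF//; lra.
apply: (mulfI cs); rewrite mulfV// mulrC -subr_sqr sE; ring.
Qed.

Lemma cosh_ln2 : cosh (ln 2) = 5 / 4 :> R.
Proof. by rewrite /cosh expRN lnK ?posrE//; field. Qed.

End Cosh.

Lemma hyperbolic_gauge (R : realType) :
  gauge (fun t : R => cosh t - 1) (fun t => 1 - (cosh (t / 2))^-1) (ln 2).
Proof.
split.
- by rewrite ln_gt0// ltr1n.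
- by move=> s t s0 st _; rewrite ltrD2r ltr_cosh.
- by rewrite cosh0 subrr.
- rewrite cosh_ln2; lra.
- move=> s t s0 st _; have s20 : 0 <= s / 2 by lra.
  have cs := cosh_ge1 s20; rewrite lerD2l lerN2 lef_pV2 ?posrE; last 2 first.
  + by apply: lt_le_trans (cosh_ge1 _); lra.
  + lra.
  by rewrite ler_cosh//; lra.
- move=> t t0 _; rewrite subr_gt0 invf_lt1.
  + by rewrite -[ltLHS]cosh0 ltr_cosh//; lra.
  + by apply: lt_le_trans (cosh_ge1 _); lra.
Qed.

(** As on the sphere, with the Lorentz form: x + z = 2 c m, where c is now the
    hyperbolic cosine of half the side.  The value at the midpoint is obtained by
    dividing by c >= 1 a quantity that is at least 1, so that the gain is at least
    [1 - c^-1]. *)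
Lemma hyperbolic_midpoint_convex (R : realType) T :
  midpoint_convex (hyperboloid R) (fun t => cosh t - 1)
    (fun t => 1 - (cosh (t / 2))^-1) T.
Proof.
move=> x z m p.
have E (u v : hyperboloid R) : cosh (mdist u v) = - lorentz u v.
  by rewrite -[mdist u v]/(acosh (- lorentz u v)) acoshK// lorentz_le.
set D := mdist x z => xm zm _ _ _.
have D0 : 0 <= D by exact: mdist_ge0.
set c := cosh (D / 2).
have c1 : 1 <= c by rewrite cosh_ge1//; lra.
have xzE : lorentz x z = 1 - 2 * c ^+ 2.
  by rewrite -[lorentz x z]opprK -E cosh_double -/D -/c; ring.
have {}xm : lorentz x m = - c by rewrite -[LHS]opprK -E xm.
have {}zm : lorentz z m = - c by rewrite -[LHS]opprK -E zm.
have xp := lorentz_le x p; have zp := lorentz_le z p; rewrite !E.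
have /andP[/eqP xx _] := hyperboloidP x; have /andP[/eqP zz _] := hyperboloidP z.
have /andP[/eqP mm _] := hyperboloidP m.
(* v is null and orthogonal to the timelike vector m, hence zero *)
have mE : lorentz x p + lorentz z p = 2 * c * lorentz m p.
  pose v i := x 0 i + z 0 i - 2 * c * m 0 i.
  have vv : v 0 ^+ 2 = v 1 ^+ 2 + v 2 ^+ 2.
    apply/eqP; rewrite eq_sym -subr_eq0; apply/eqP.
    transitivity (lorentz x x + lorentz z z + 4 * c ^+ 2 * lorentz m m +
        2 * lorentz x z - 4 * c * lorentz x m - 4 * c * lorentz z m).
      by rewrite /v /lorentz; ring.
    by rewrite xx zz mm xm zm xzE; ring.
  have vm : v 0 * m 0 0 = v 1 * m 0 1 + v 2 * m 0 2.
    apply/eqP; rewrite eq_sym -subr_eq0; apply/eqP.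
    transitivity (lorentz x m + lorentz z m - 2 * c * lorentz m m).
      by rewrite /v /lorentz; ring.
    by rewrite xm zm mm; ring.
  have v0 : v 0 ^+ 2 <= 0.
    have -> : v 0 ^+ 2 = - (v 1 * m 0 2 - v 2 * m 0 1) ^+ 2.
      have : (v 0 * m 0 0) ^+ 2 =
          (v 1 ^+ 2 + v 2 ^+ 2) * (m 0 1 ^+ 2 + m 0 2 ^+ 2) -
          (v 1 * m 0 2 - v 2 * m 0 1) ^+ 2 by rewrite vm; ring.
      rewrite -vv exprMn.
      have -> : m 0 1 ^+ 2 + m 0 2 ^+ 2 = m 0 0 ^+ 2 - 1.
        by move: mm; rewrite /lorentz; lra.
      lra.
    by rewrite oppr_le0 sqr_ge0.
  have h0 := sqr_ge0 (v 0); have h1 := sqr_ge0 (v 1); have h2 := sqr_ge0 (v 2).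
  have /eqP : v 0 ^+ 2 = 0 by lra.
  have /eqP : v 1 ^+ 2 = 0 by lra.
  have /eqP : v 2 ^+ 2 = 0 by lra.
  rewrite !sqrf_eq0 !subr_eq0 !(eq_sym _ (2 * c * _)) /lorentz.
  rewrite mulrBr mulrDr !(mulrA (2 * c)) => /eqP-> /eqP-> /eqP->; ring.
have mE' : - lorentz m p = (- lorentz x p - lorentz z p) / 2 * c^-1.
  rewrite -opprD mE; field; lra.
have ic1 : c^-1 <= 1 by rewrite invf_le1//; lra.
rewrite mE'; move: xp zp.
move: (- lorentz x p) (- lorentz z p) (c^-1) ic1 => a b i i1 a1 b1.
have := mulr_ge0 (_ : 0 <= 1 - i) (_ : 0 <= (a + b) / 2 - 1).
rewrite !subr_ge0 i1 => /(_ isT); lra.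
Qed.

(** The bound on [3 * T] makes the comparison of triangles available as soon as
    the three sides are at most [T]. *)
Lemma model_surface_midpoint_convex (R : realType) (k : R) :
  exists (g w : R -> R) (T : R),
    [/\ gauge g w T, ((3 * T)%:E < 2%:E * model_diam k)%E &
        midpoint_convex (model_surface k) g w T].
Proof.
rewrite /model_surface; case: eqVneq => [k0|k0].
  exists (fun t => t ^+ 2), (fun t => t ^+ 2 / 4), 1; split.
  - exact: euclidean_gauge.
  - by rewrite /model_diam k0 ltxx mulry gtr0_sg// mul1e ltry.
  - exact: euclidean_midpoint_convex.
have q0 := model_scale_gt0 k0.
case: ifPn => kpos.
  do 3 eexists; split.
  - apply: gauge_scale q0 _; exact: sphere_gauge.
  - rewrite /model_diam kpos gtr0_norm// -EFinM lte_fin.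
    have p0 := pi_gt0 R; have := acos_half_le R.
    have ik : 0 < (Num.sqrt k)^-1 by rewrite invr_gt0 sqrtr_gt0.
    by rewrite mulrCA [ltRHS]mulrA [ltRHS]mulrC ltr_pM2l//; lra.
  - exact: midpoint_convex_scale (@sphere_midpoint_convex R).
do 3 eexists; split.
- apply: gauge_scale q0 _; exact: hyperbolic_gauge.
- by rewrite /model_diam (negPf kpos) mulry gtr0_sg// mul1e ltry.
- exact: midpoint_convex_scale (@hyperbolic_midpoint_convex R _).
Qed.

(** * Uniform convexity of distances in a space of bounded curvature *)

Lemma geodesic_midpoint (R : realType) (X : metricType R) (x z : X)
    (c : R -> X) : is_geodesic x z c ->
  let m := c (mdist x z / 2) in
  mdist x m = mdist x z / 2 /\ mdist z m = mdist x z / 2.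
Proof.
case=> c0 cD cd /=; have D0 := mdist_ge0 x z.
split.
- rewrite -{1}c0 cd ?in_itv/=; [|lra|lra].
  by rewrite sub0r normrN ger0_norm//; lra.
- rewrite -{1}cD cd ?in_itv/=; [|lra|lra].
  by rewrite ger0_norm//; lra.
Qed.

(** The triangle with vertices x, z, p is compared with its model, where the
    inequality holds for the midpoint of the side from x to z. *)
Lemma CAT_midpoint (R : realType) (k : R) (X : metricType R)
    (g w : R -> R) (T : R) :
  gauge g w T -> ((3 * T)%:E < 2%:E * model_diam k)%E ->
  midpoint_convex (model_surface k) g w T -> CAT k X ->
  forall x z : X, exists m : X, forall p : X,
    mdist x z <= T -> mdist x p <= T -> mdist z p <= T ->
    g (Order.min (mdist m p) T) <=
      (g (mdist x p) + g (mdist z p)) / 2 - w (mdist x z).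
Proof.
move=> [T0 gm g0 g1 wm w0] TD cM [geoX catX] x z.
have [c cxz] := geoX x z; exists (c (mdist x z / 2)) => p xzT xpT zpT.
have [c1 czp] := geoX z p; have [c2 cpx] := geoX p x.
(* vertices x, z, p; the midpoint lies on side 0, and p is the start of side 2 *)
pose v (i : 'I_3) := nth x [:: x; z; p] i.
pose e (i : 'I_3) := nth c [:: c; c1; c2] i.
have i01 : (0 : 'I_3) + 1 = 1 by apply/val_inj.
have i12 : (1 : 'I_3) + 1 = 2 by apply/val_inj.
have i20 : (2 : 'I_3) + 1 = 0 by apply/val_inj.
have I3 (P : 'I_3 -> Prop) : P 0 -> P 1 -> P 2 -> forall i, P i.
  move=> P0 P1 P2 [[|[|[|//]]] i3].
  - by rewrite (_ : Ordinal i3 = 0)//; apply/val_inj.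
  - by rewrite (_ : Ordinal i3 = 1)//; apply/val_inj.
  - by rewrite (_ : Ordinal i3 = 2)//; apply/val_inj.
have tri : geodesic_triangle v e by apply: I3; rewrite ?i01 ?i12 ?i20.
have per : ((perimeter v)%:E < 2%:E * model_diam k)%E.
  apply: le_lt_trans TD; rewrite lee_fin /perimeter.
  rewrite (_ : 3 * T = \sum_(i < 3) T); last first.
    by rewrite sumr_const card_ord mulr_natl.
  apply: ler_sum => i _; rewrite /side_length; move: i.
  by apply: I3; rewrite ?i01 ?i12 ?i20//= metric_sym.
have [v' [c' [tri' len' cmp]]] := catX _ _ tri per.
have xzE : mdist (v' 0) (v' 1) = mdist x z.
  by have := len' 0; rewrite /side_length i01.
have zpE : mdist (v' 1) (v' 2) = mdist z p.
  by have := len' 1; rewrite /side_length i12.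
have pxE : mdist (v' 2) (v' 0) = mdist p x.
  by have := len' 2; rewrite /side_length i20.
have geo' := tri' 0; rewrite i01 in geo'.
have [xm zm] := geodesic_midpoint geo'; rewrite xzE in xm zm.
set m' := c' 0 _ in xm zm.
have mp : mdist (c (mdist x z / 2)) p <= mdist m' (v' 2).
  have [p0 _ _] := tri' 2; have [p1 _ _] := cpx.
  rewrite -p0 -{1}p1; apply: (cmp 0 2).
  - by rewrite in_itv/= /side_length i01/=; have := mdist_ge0 x z; lra.
  - by rewrite in_itv/= lexx /side_length mdist_ge0.
have := cM (v' 0) (v' 1) m' (v' 2).
rewrite !xzE zpE [mdist (v' 0) (v' 2)]metric_sym pxE [mdist p x]metric_sym.
move=> /(_ xm zm xzT xpT zpT); apply: le_trans.
have m'2T : mdist m' (v' 2) <= 2 * T.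
  have := metric_triangle m' (v' 0) (v' 2).
  by rewrite [mdist m' (v' 0)]metric_sym xm [mdist (v' 0) (v' 2)]metric_sym pxE
    [mdist p x]metric_sym; lra.
have : Order.min (mdist (c (mdist x z / 2)) p) T <= mdist m' (v' 2).
  by rewrite ge_min mp.
rewrite le_eqVlt => /predU1P[->//|lt]; apply/ltW/gm => //.
by rewrite le_min mdist_ge0 ltW.
Qed.

(** One m serves all p, so that the inequality survives a supremum over p. *)
Definition uniformly_convex_at (R : realType) (X : metricType R)
    (G w : R -> R) (x0 : X) (r : R) : Prop :=
  forall x z : X, mdist x0 x < r -> mdist x0 z < r ->
  exists m : X, forall p : X, mdist x0 p < r ->
    G (mdist m p) <= (G (mdist x p) + G (mdist z p)) / 2 - w (mdist x z).

(** The global counterpart of [gauge], obtained by truncation at [T]: bounded and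
    monotone on the whole half-line, strictly monotone only up to [T].  Bounds that
    hold on the whole of X make the cost finite and let its minimization range
    over X instead of a ball chosen for each point. *)
Record global_gauge (R : realType) (G w : R -> R) (T : R) : Prop := GlobalGauge {
  global_gauge_pos : 0 < T;
  global_gauge_mono : forall s t, 0 <= s -> s <= t -> G s <= G t;
  global_gauge_lt : forall s t, 0 <= s -> s < t -> t <= T -> G s < G t;
  global_gauge_ge0 : forall s, 0 <= s -> 0 <= G s;
  global_gauge_le1 : forall s, 0 <= s -> G s <= 1;
  global_gauge_modulus_mono : forall s t, 0 <= s -> s <= t -> t <= T -> w s <= w t;
  global_gauge_modulus_gt0 : forall t, 0 < t -> t <= T -> 0 < w t }.

Lemma truncated_gauge (R : realType) (g w : R -> R) (T : R) :
  gauge g w T -> global_gauge (fun t => g (Order.min t T)) w T.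
Proof.
move=> [T0 gm g0 g1 wm w0].
have gle s t : 0 <= s -> s <= t -> t <= T -> g s <= g t.
  move=> s0; rewrite le_eqVlt => /predU1P[->//|st] tT.
  by apply/ltW/gm => //; lra.
have m0 s : 0 <= s -> 0 <= Order.min s T by move=> s0; rewrite le_min s0 ltW.
have mT s : Order.min s T <= T by rewrite ge_min lexx orbT.
split=> //.
- by move=> s t s0 st; apply: gle; rewrite ?m0 ?mT// le_min mT ge_min st.
- move=> s t s0 st tT; rewrite !min_l//; last by rewrite ltW// (lt_le_trans st).
  by apply: gm => //; lra.
- by move=> s s0; rewrite (le_trans g0)// gle ?m0 ?mT.
- by move=> s s0; rewrite (le_trans _ g1)// gle ?m0 ?mT.
Qed.

(** Two points of a ball of radius at most [T / 2] are within [T] of each other, so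
    that truncation affects at most the value at the midpoint, which it lowers. *)
Lemma curvature_le_uniformly_convex (R : realType) (k : R) (X : metricType R) :
  curvature_le k X ->
  exists (G w : R -> R) (T : R), global_gauge G w T /\
    forall x0 : X, exists r, [/\ 0 < r, 2 * r <= T & uniformly_convex_at G w x0 r].
Proof.
case=> _ curv; have [g [w [T [gw TD cM]]]] := model_surface_midpoint_convex k.
exists (fun t => g (Order.min t T)), w, T; split; first exact: truncated_gauge.
move=> x0; have [r r0 catB] := curv x0.
have T0 := gauge_pos gw.
exists (Order.min r (T / 2)); split.
- by rewrite lt_min r0/=; lra.
- have : Order.min r (T / 2) <= T / 2 by rewrite ge_min lexx orbT.
  lra.
have near (u v : X) : mdist x0 u < Order.min r (T / 2) ->
    mdist x0 v < Order.min r (T / 2) -> mdist u v <= T.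
  rewrite !lt_min => /andP[_ u0] /andP[_ v0].
  by have := metric_triangle u x0 v; rewrite [mdist u x0]metric_sym; lra.
have inB (u : X) : mdist x0 u < Order.min r (T / 2) -> u \in (ball x0 r : set X).
  by rewrite lt_min => /andP[u0 _]; rewrite inE ballEmdist.
move=> x z xr zr.
pose B := set_type (ball x0 r).
pose xB : B := SigSub (inB _ xr); pose zB : B := SigSub (inB _ zr).
have [m mP] := CAT_midpoint gw TD cM catB xB zB.
exists (set_val m) => p pr.
have xpT := near _ _ xr pr; have zpT := near _ _ zr pr.
rewrite (min_l xpT) (min_l zpT).
exact: (mP (SigSub (inB _ pr)) (near _ _ xr zr)).
Qed.

(** * The centre of the part of a closed subspace seen from a point *)

Section Center.
Context {R : realType} {X Y : metricType R} (h : X -> Y) (G : R -> R).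

Definition gap (y : Y) : R := inf [set mdist y (h p) | p in [set: X]].

Definition weight (y : Y) (p : X) : R :=
  Order.min 1 (Order.max 0 (3 - mdist y (h p) / gap y)).

(** The factor 2 exceeds the bound 1 of [G], so that the points of weight 0 never
    contribute to the supremum: those of weight 1 give at least 2. *)
Definition cost (y : Y) (x : X) : R :=
  sup [set G (mdist x p) + 2 * weight y p | p in [set: X]].

Definition near_min (y : Y) (tau : R) (z : X) : Prop :=
  forall u : X, cost y z <= cost y u + tau.

(** The limit of near-minimizers, which completeness provides whether or not the
    infimum of the cost is attained. *)
Definition is_center (y : Y) (x : X) : Prop :=
  forall e : R, 0 < e -> exists2 tau : R, 0 < tau &
    forall z, near_min y tau z -> mdist z x <= e.

Lemma gap_has_lb y : has_lbound [set mdist y (h p) | p in [set: X]].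
Proof. by exists 0 => _ [p _ <-]; exact: mdist_ge0. Qed.

Lemma gap_le y p : gap y <= mdist y (h p).
Proof. by apply: ge_inf; [exact: gap_has_lb|exists p]. Qed.

Lemma gap_lipschitz (x0 : X) y y' : gap y <= mdist y y' + gap y'.
Proof.
rewrite -lerBlDl; apply: lb_le_inf; first by exists (mdist y' (h x0)), x0.
move=> _ [p _ <-]; rewrite lerBlDl; apply: le_trans (gap_le y p) _.
exact: metric_triangle.
Qed.

Lemma gap_gt0 (x0 : X) y : closed (range h) -> ~ range h y -> 0 < gap y.
Proof.
move=> clA yA; have /nbhs_ballP[e /= e0 eA] : nbhs y (~` range h).
  by apply: open_nbhs_nbhs; split => //; exact: closed_openC.
apply: (lt_le_trans e0); apply: lb_le_inf; first by exists (mdist y (h x0)), x0.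
move=> _ [p _ <-]; rewrite leNgt; apply/negP => lt.
by apply: (eA (h p)); [rewrite ballEmdist|exists p].
Qed.

Lemma gap_approx (x0 : X) y c : 0 < gap y -> 1 < c ->
  exists p, mdist y (h p) < c * gap y.
Proof.
move=> g0 c1; have e0 : 0 < (c - 1) * gap y by rewrite mulr_gt0 ?subr_gt0.
have [|_ [p _ <-]] := inf_adherent e0 (E := [set mdist y (h p) | p in setT]).
  by split; [exists (mdist y (h x0)), x0|exact: gap_has_lb].
by rewrite -/(gap y) => lt; exists p; apply: (lt_le_trans lt); lra.
Qed.

Lemma weight_ge0 y p : 0 <= weight y p.
Proof. by rewrite /weight le_min ler01 le_max lexx. Qed.

Lemma weight_le1 y p : weight y p <= 1.
Proof. by rewrite /weight ge_min lexx. Qed.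

Lemma weight0 y p : 0 < gap y -> 3 * gap y <= mdist y (h p) -> weight y p = 0.
Proof.
move=> g0 far; rewrite /weight max_l ?min_r ?ler01//.
by rewrite subr_le0 ler_pdivlMr.
Qed.

Lemma weight1 y p : 0 < gap y -> mdist y (h p) <= 2 * gap y -> weight y p = 1.
Proof.
move=> g0 close; rewrite /weight min_l// le_max; apply/orP; right.
by rewrite lerBrDl -lerBrDr ler_pdivrMr//; lra.
Qed.

(** Where the weight is positive, the quotient of [mdist y (h p)] by [gap y] is at
    most 3.  Its variation is therefore controlled, uniformly in p, by those of
    its numerator and denominator, which are 1-Lipschitz in y. *)
Lemma weight_lipschitz y y' p : 0 < gap y -> 0 < gap y' ->
  weight y p <= weight y' p + 4 * mdist y y' / gap y'.
Proof.
move=> g0 g'0; have x0 := p.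
have e0 := mdist_ge0 y y'; have d0 := mdist_ge0 y (h p).
have q0 : 0 <= 4 * mdist y y' / gap y' by rewrite divr_ge0 ?(ltW g'0)// mulr_ge0.
have [far|close] := leP (3 * gap y) (mdist y (h p)).
  by rewrite weight0// addr_ge0 ?weight_ge0.
rewrite -lerBlDr {2}/weight le_min; apply/andP; split.
  by have := weight_le1 y p; lra.
rewrite le_max; apply/orP; right; rewrite lerBlDr.
apply: (@le_trans _ _ (3 - mdist y (h p) / gap y)).
  rewrite /weight ge_min ge_max; apply/orP; right; rewrite lexx andbT.
  by rewrite subr_ge0 ler_pdivrMr// ltW.
rewrite -subr_ge0.
have gg := gap_lipschitz x0 y y'.
have dd : mdist y' (h p) <= mdist y y' + mdist y (h p).
  by rewrite [mdist y y']metric_sym metric_triangle.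
have -> : 3 - mdist y' (h p) / gap y' + 4 * mdist y y' / gap y' -
    (3 - mdist y (h p) / gap y) =
  (4 * mdist y y' * gap y + mdist y (h p) * gap y' - mdist y' (h p) * gap y) /
  (gap y * gap y').
  by field; rewrite !gt_eqF.
apply: divr_ge0; last by rewrite ltW// mulr_gt0.
(* the sum of the next three products is the numerator *)
have h1 := mulr_ge0 (_ : 0 <= mdist y y' + mdist y (h p) - mdist y' (h p))
  (ltW g0).
have h2 := mulr_ge0 (_ : 0 <= mdist y y' + gap y' - gap y) d0.
have h3 := mulr_ge0 e0 (_ : 0 <= 3 * gap y - mdist y (h p)).
move: h1 h2 h3; rewrite !subr_ge0 => /(_ dd) h1 /(_ gg) h2 /(_ (ltW close)) h3.
lra.
Qed.

Section Cost.
Context (w : R -> R) (T : R) (cG : global_gauge G w T).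

Lemma cost_ub y x :
  ubound [set G (mdist x p) + 2 * weight y p | p in [set: X]] 3.
Proof.
move=> _ [p _ <-]; have := weight_le1 y p.
have := global_gauge_le1 cG (mdist_ge0 x p); lra.
Qed.

Lemma cost_ge y x p : G (mdist x p) + 2 * weight y p <= cost y x.
Proof.
by apply: ub_le_sup; [exists 3; exact: cost_ub|exists p].
Qed.

Lemma cost_le y x b :
  (forall p, G (mdist x p) + 2 * weight y p <= b) -> cost y x <= b.
Proof.
move=> H; apply: ge_sup; first by exists (G (mdist x x) + 2 * weight y x), x.
by move=> _ [p _ <-].
Qed.

Lemma cost_ge0 y x : 0 <= cost y x.
Proof.
apply: le_trans (cost_ge y x x).
by rewrite addr_ge0 ?(global_gauge_ge0 cG) ?mdist_ge0 ?mulr_ge0 ?weight_ge0.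
Qed.

Lemma cost_ge2 y x : 0 < gap y -> 2 <= cost y x.
Proof.
move=> g0; have [||p py] := gap_approx x (y := y) (c := 2); rewrite ?ltr1n//.
apply: le_trans (cost_ge y x p); rewrite (weight1 g0 (ltW py)).
by have := global_gauge_ge0 cG (mdist_ge0 x p); lra.
Qed.

Lemma cost_lipschitz y y' x : 0 < gap y -> 0 < gap y' ->
  cost y x <= cost y' x + 8 * mdist y y' / gap y'.
Proof.
move=> g0 g'0; apply: cost_le => p.
have := weight_lipschitz p g0 g'0; have := cost_ge y' x p.
rewrite (_ : 8 * _ / _ = 2 * (4 * mdist y y' / gap y')); first lra.
by rewrite !mulrA -natrM.
Qed.

Lemma near_minW y s t z : s <= t -> near_min y s z -> near_min y t z.
Proof. by move=> st zs u; apply: le_trans (zs u) _; rewrite lerD2l. Qed.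

Lemma near_min_exists (x0 : X) y tau : 0 < tau -> exists z, near_min y tau z.
Proof.
move=> tau0.
have inf_cost : has_inf [set cost y u | u in [set: X]].
  by split; [exists (cost y x0), x0|exists 0 => _ [u _ <-]; exact: cost_ge0].
have [_ [z _ <-] zlt] := inf_adherent tau0 inf_cost.
exists z => u; apply: (le_trans (ltW zlt)); rewrite lerD2r.
by apply: ge_inf; [exact: inf_cost.2|exists u].
Qed.

(** If all points of positive weight are within [s] of [x0], then
    [cost y x0 <= G s + 2], whereas a point [z] with [cost y z < G t + 2] is within
    [t] of every point of weight 1. *)
Lemma near_min_local y x0 s t tau z : 0 < gap y -> 0 <= s -> 0 <= t ->
  (forall p, mdist y (h p) < 3 * gap y -> mdist x0 p < s) ->
  G s + tau < G t -> near_min y tau z -> mdist x0 z < s + t.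
Proof.
move=> g0 s0 t0 act lt zmin.
have Gs0 := global_gauge_ge0 cG s0.
have x0c : cost y x0 <= G s + 2.
  apply: cost_le => p; have [far|close] := leP (3 * gap y) (mdist y (h p)).
    by rewrite weight0//; have := global_gauge_le1 cG (mdist_ge0 x0 p); lra.
  have := global_gauge_mono cG (mdist_ge0 x0 p) (ltW (act _ close)).
  by have := weight_le1 y p; lra.
have [||p py] := gap_approx x0 (y := y) (c := 2); rewrite ?ltr1n//.
have zp := cost_ge y z p; rewrite (weight1 g0 (ltW py)) in zp.
have zx0 := zmin x0.
have {}zp : mdist z p < t.
  by rewrite ltNge; apply/negP => /(global_gauge_mono cG t0); lra.
have py3 : mdist y (h p) < 3 * gap y by lra.
have := act _ py3; have := metric_triangle x0 p z.
by rewrite [mdist p z]metric_sym; lra.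
Qed.

(** The radius [r / 4] leaves room for the near-minimizers themselves to lie in the
    ball of radius [r] where convexity holds. *)
Definition well_seen (y : Y) : Prop := exists x0 r,
  [/\ 0 < r, 2 * r <= T, uniformly_convex_at G w x0 r &
      forall p, mdist y (h p) < 3 * gap y -> mdist x0 p < r / 4].

(** At the point m given by uniform convexity for z and z', the cost is smaller
    than the mean of the costs of z and z' by at least [w (mdist z z')]; near-minimality
    bounds this gain by [tau]. *)
Lemma near_min_close y : 0 < gap y -> well_seen y ->
  forall e, 0 < e -> exists2 tau, 0 < tau &
  forall z z', near_min y tau z -> near_min y tau z' -> mdist z z' < e.
Proof.
move=> g0 [x0 [r [r0 rT cvx act]]] e e0.
have T0 := global_gauge_pos cG.
have Glt : G (r / 4) < G (r / 2) by apply: (global_gauge_lt cG); lra.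
pose e' := Order.min e T.
have e'0 : 0 < e' by rewrite lt_min e0.
have e'T : e' <= T by rewrite ge_min lexx orbT.
have we' := global_gauge_modulus_gt0 cG e'0 e'T.
pose tau := Order.min ((G (r / 2) - G (r / 4)) / 2) (w e' / 2).
have tauG : tau <= (G (r / 2) - G (r / 4)) / 2 by rewrite ge_min lexx.
have tauw : tau <= w e' / 2 by rewrite ge_min lexx orbT.
exists tau; first by rewrite lt_min; apply/andP; split; lra.
move=> z z' zmin z'min.
have local u : near_min y tau u -> mdist x0 u < r.
  move=> umin; have : mdist x0 u < r / 4 + r / 2; last by lra.
  by apply: (near_min_local g0 _ _ act _ umin); lra.
have zr := local _ zmin; have z'r := local _ z'min.
have [m mP] := cvx _ _ zr z'r.
have wzz' : w (mdist z z') <= tau.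
  have x0r : mdist x0 x0 < r by rewrite mdistxx.
  have z2 := cost_ge2 z g0; have z'2 := cost_ge2 z' g0.
  have : cost y m <= (cost y z + cost y z') / 2 - w (mdist z z').
    apply: cost_le => p; have [far|close] := leP (3 * gap y) (mdist y (h p)).
      (* here G <= 1, while both costs are at least 2 and the gain is at most 1 *)
      rewrite weight0// mulr0 addr0.
      have := mP _ x0r; have := global_gauge_ge0 cG (mdist_ge0 m x0).
      have := global_gauge_le1 cG (mdist_ge0 z x0).
      have := global_gauge_le1 cG (mdist_ge0 z' x0).
      have := global_gauge_le1 cG (mdist_ge0 m p); lra.
    have pr : mdist x0 p < r by have := act _ close; lra.
    have := mP _ pr; have := cost_ge y z p; have := cost_ge y z' p; lra.
  have := zmin m; have := z'min m; lra.
rewrite ltNge; apply/negP => ezz'.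
have : w e' <= w (mdist z z').
  apply: (global_gauge_modulus_mono cG); first exact: ltW.
  - by rewrite ge_min ezz'.
  - have := metric_triangle z x0 z'; rewrite [mdist z x0]metric_sym; lra.
lra.
Qed.

Lemma center_unique (x0 : X) y x x' : is_center y x -> is_center y x' -> x = x'.
Proof.
move=> cx cx'; apply: mdist_positivity; apply/eqP; rewrite eq_le mdist_ge0 andbT.
apply/ler_addgt0Pl => e e0; rewrite addr0.
have e20 : 0 < e / 2 by lra.
have [t t0 xt] := cx _ e20; have [t' t'0 x't'] := cx' _ e20.
have [|z zmin] := near_min_exists x0 y (tau := Order.min t t').
  by rewrite lt_min t0.
have := xt z (near_minW _ zmin); rewrite ge_min lexx => /(_ isT).
have := x't' z (near_minW _ zmin); rewrite ge_min lexx orbT => /(_ isT).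
have := metric_triangle x z x'; rewrite [mdist x z]metric_sym; lra.
Qed.

Lemma center_exists y : metric_complete X -> 0 < gap y -> well_seen y ->
  exists x, is_center y x.
Proof.
move=> complX g0 ws; have [x0 _] := ws.
have close := near_min_close g0 ws.
have /choice[u uP] n : exists z, near_min y (n.+1%:R^-1) z.
  by apply: near_min_exists => //; rewrite invr_gt0.
have eventually_min tau : 0 < tau -> \forall n \near \oo, near_min y tau (u n).
  move=> tau0; have := near_infty_natSinv_lt (PosNum tau0).
  by apply: filterS => n lt; exact: near_minW (ltW lt) (uP n).
have [x ux] : exists x : X, u @ \oo --> x.
  apply: complX; apply/cauchy_ballP => e e0.
  have [tau tau0 tauP] := close _ e0.
  have [N _ NP] := eventually_min _ tau0.
  exists (near_min y tau, near_min y tau); first by split; exists N.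
  by move=> [z z'] [/= zmin z'min]; rewrite ballEmdist; exact: tauP.
exists x => e e0; have e20 : 0 < e / 2 by lra.
have [tau tau0 tauP] := close _ e20; exists tau => // z zmin.
have : \forall n \near \oo, near_min y tau (u n) /\ ball x (e / 2) (u n).
  by apply: filterI; [exact: eventually_min|move/cvg_ballP: ux; exact].
move=> /filter_ex[n [umin]]; rewrite ballEmdist /= => xu.
have := tauP _ _ zmin umin; have := metric_triangle z (u n) x.
rewrite [mdist (u n) x]metric_sym; lra.
Qed.

(** Near y the costs differ from [cost y] by at most a small multiple of [tau], so
    a good near-minimizer at y' is a near-minimizer at y: it is close to both
    centres. *)
Lemma center_continuous y x : 0 < gap y -> is_center y x ->
  forall e, 0 < e -> exists2 d, 0 < d &
  forall y' x', mdist y y' < d -> is_center y' x' -> mdist x x' <= e.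
Proof.
move=> g0 cx e e0; have e20 : 0 < e / 2 by lra.
have [tau tau0 tauP] := cx _ e20.
pose d := Order.min (gap y / 2) (tau * gap y / 128).
have dg : d <= gap y / 2 by rewrite ge_min lexx.
have dt : d <= tau * gap y / 128 by rewrite ge_min lexx orbT.
exists d; first by rewrite lt_min !divr_gt0 ?mulr_gt0.
move=> y' x' yy' cx'.
have g'g : gap y / 2 <= gap y' by have := gap_lipschitz x y y'; lra.
have g'0 : 0 < gap y' by lra.
have small c : gap y / 2 <= c -> 8 * mdist y y' / c <= tau / 8.
  move=> gc; have := mulr_ge0 (ltW tau0) (_ : 0 <= c - gap y / 2).
  by rewrite subr_ge0 => /(_ gc) h0; rewrite ler_pdivrMr; lra.
have [tau' tau'0 tau'P] := cx' _ e20.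
have [|z zmin] := near_min_exists x y' (tau := Order.min tau' (tau / 4)).
  by rewrite lt_min tau'0; lra.
have zmin4 : near_min y' (tau / 4) z.
  by apply: near_minW zmin; rewrite ge_min lexx orbT.
have zx : mdist z x <= e / 2.
  apply: tauP => u; have := zmin4 u.
  have := cost_lipschitz z g0 g'0; have := cost_lipschitz u g'0 g0.
  rewrite [mdist y' y]metric_sym.
  have g2 : gap y / 2 <= gap y by lra.
  by have := small _ g'g; have := small _ g2; lra.
have zx' : mdist z x' <= e / 2.
  by apply: tau'P; apply: near_minW zmin; rewrite ge_min lexx.
have := metric_triangle x z x'; rewrite [mdist x z]metric_sym; lra.
Qed.

(** This is continuity at the points of the closed subspace, near which [s] tends
    to 0.  A near-minimizer is within [s + 2 * s] of [x0] by [near_min_local], and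
    the centre within [s] of a near-minimizer. *)
Lemma center_near y x0 x s : 0 < gap y -> 0 < s -> 2 * s <= T ->
  (forall p, mdist y (h p) < 3 * gap y -> mdist x0 p < s) ->
  is_center y x -> mdist x0 x <= 4 * s.
Proof.
move=> g0 s0 sT act cx; have [tau tau0 tauP] := cx _ s0.
have Glt : G s < G (2 * s) by apply: (global_gauge_lt cG); lra.
pose t := Order.min tau ((G (2 * s) - G s) / 2).
have tG : t <= (G (2 * s) - G s) / 2 by rewrite ge_min lexx orbT.
have [|z zmin] := near_min_exists x0 y (tau := t).
  by rewrite lt_min tau0; lra.
have zx : mdist z x <= s.
  by apply: tauP; apply: near_minW zmin; rewrite ge_min lexx.
have := near_min_local g0 (ltW s0) (_ : 0 <= 2 * s) act _ zmin.
have s20 : 0 <= 2 * s by lra.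
have lt : G s + t < G (2 * s) by lra.
move=> /(_ s20 lt); have := metric_triangle x0 z x; lra.
Qed.

End Cost.

End Center.

(** * Retraction onto a closed copy of a uniformly convex space *)

Lemma embedding_inverse_continuous (R : realType) (X Y : metricType R)
    (h : X -> Y) : embedding h ->
  forall x0 e, 0 < e -> exists2 d, 0 < d &
    forall p, mdist (h x0) (h p) < d -> mdist x0 p < e.
Proof.
move=> [hinj _ [g gcont gK]] x0 e e0.
have imP p : h p \in range h by rewrite inE; exists p.
pose im p : set_type (range h) := SigSub (imP p).
have gim p : g (im p) = p by apply: hinj; rewrite gK.
have /cvg_ballP/(_ _ e0)/nbhs_ballP[d /= d0 dP] := gcont (im x0).
exists d => // p lt; have := dP (im p).
by rewrite /= !ballEmdist /= !gim; apply.
Qed.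

(** The neighbourhood is the union of balls about the points [h x0] small enough
    for the part of the subspace seen from their points to lie deep in a ball of
    uniform convexity. *)
Lemma uniformly_convex_ANR (R : realType) (X : metricType R)
    (G w : R -> R) (T : R) :
  metric_complete X -> global_gauge G w T ->
  (forall x0 : X, exists r, [/\ 0 < r, 2 * r <= T & uniformly_convex_at G w x0 r]) ->
  absolute_neighborhood_retract X.
Proof.
move=> complX cG cvx Y h emb clA.
have [hinj hcont _] := emb; have hinv := embedding_inverse_continuous emb.
pose U := [set y | exists x0 r d, [/\ [/\ 0 < r, 2 * r <= T &
    uniformly_convex_at G w x0 r], mdist (h x0) y < d &
    forall p, mdist (h x0) (h p) < 4 * d -> mdist x0 p < r / 4]].
(* xget returns its default y where there is no centre: only off U *)
pose f y := if y \in range h then y else xget y (h @` [set x | is_center h G y x]).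
have fA y : range h y -> f y = y by move=> yA; rewrite /f mem_set.
have f_center y x : ~ range h y -> is_center h G y x -> f y = h x.
  move=> yA cx; rewrite /f memNset//; apply: xget_unique; first by exists x.
  by move=> _ [x' cx' <-]; rewrite (center_unique cG x cx cx').
have gap0 y (x0 : X) : ~ range h y -> 0 < gap h y by exact: (gap_gt0 x0 clA).
have U_center y : U y -> ~ range h y -> exists x, is_center h G y x.
  move=> [x0 [r [d [[r0 rT cv] x0y near]]]] yA.
  apply: (center_exists cG complX); first exact: gap0.
  exists x0, r; split=> // p yp; apply: near.
  have := gap_le h y x0; rewrite [mdist y _]metric_sym.
  have := metric_triangle (h x0) y (h p); lra.
have openU : open U.
  rewrite openE => y [x0 [r [d [cv x0y near]]]]; apply/nbhs_ballP.
  exists (d - mdist (h x0) y) => /=; first by rewrite subr_gt0.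
  move=> y'; rewrite ballEmdist /= => yy'; exists x0, r, d; split=> //.
  by have := metric_triangle (h x0) y y'; lra.
exists U, f; split=> //.
- move=> _ [x0 _ <-]; have [r [r0 rT cv]] := cvx x0.
  have r40 : 0 < r / 4 by lra.
  have [d d0 dP] := hinv x0 _ r40.
  exists x0, r, (d / 4); split=> //; first by rewrite mdistxx; lra.
  by move=> p lt; apply: dP; lra.
- rewrite continuous_open_subspace// => y /set_mem Uy; apply/cvg_ballP => e e0.
  have [yA|yA] := pselect (range h y).
  + have [x0 _ x0y] := yA; rewrite (fA _ yA).
    move: (hcont x0) => /cvg_ballP/(_ _ e0)/nbhs_ballP[d /= d0 dP].
    have T0 := global_gauge_pos cG.
    pose s := Order.min (d / 5) (T / 2).
    have sd : s <= d / 5 by rewrite ge_min lexx.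
    have sT : s <= T / 2 by rewrite ge_min lexx orbT.
    have s0 : 0 < s by rewrite lt_min; apply/andP; split; lra.
    have [b b0 bP] := hinv x0 _ s0.
    near=> y'.
    have Uy' : U y' by near: y'; exact: open_nbhs_nbhs.
    have yy' : mdist y y' < Order.min e (b / 4).
      near: y'; apply/nbhs_ballP; exists (Order.min e (b / 4)) => /=.
        by rewrite lt_min e0; lra.
      by move=> y'; rewrite ballEmdist.
    move: yy'; rewrite lt_min => /andP[yy'e yy'b].
    have [y'A|y'A] := pselect (range h y'); first by rewrite fA// ballEmdist.
    have [x cx] := U_center _ Uy' y'A; rewrite (f_center _ _ y'A cx) -x0y.
    apply: dP; rewrite ballEmdist /=.
    have : mdist x0 x <= 4 * s; last by lra.
    apply: (center_near cG (gap0 _ x0 y'A) s0 _ _ cx); first by lra.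
    move=> p y'p; apply: bP; rewrite x0y; have := gap_le h y' x0.
    rewrite x0y [mdist y' y]metric_sym; have := metric_triangle y y' (h p); lra.
  + have [x cx] := U_center _ Uy yA; rewrite (f_center _ _ yA cx).
    move: (hcont x) => /cvg_ballP/(_ _ e0)/nbhs_ballP[d /= d0 dP].
    have d20 : 0 < d / 2 by lra.
    have [b b0 bP] := center_continuous cG (gap0 _ x yA) cx d20.
    near=> y'.
    have Uy' : U y' by near: y'; exact: open_nbhs_nbhs.
    have y'A : ~ range h y'.
      near: y'; apply: (@open_nbhs_nbhs _ y (~` range h)).
      by split => //; exact: closed_openC.
    have yy' : mdist y y' < b.
      by near: y'; apply/nbhs_ballP; exists b => // y'; rewrite ballEmdist.
    have [x' cx'] := U_center _ Uy' y'A; rewrite (f_center _ _ y'A cx').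
    apply: dP; rewrite ballEmdist /=.
    by have := bP _ _ yy' cx'; lra.
- move=> _ [y Uy <-]; have [yA|yA] := pselect (range h y); first by rewrite fA.
  by have [x cx] := U_center _ Uy yA; rewrite (f_center _ _ yA cx); exists x.
Unshelve. all: by end_near. Qed.

Theorem theorem7 (R : realType) (k : R) (X : metricType R)
  (hX : metric_complete X) (hk : curvature_le k X) :
  absolute_neighborhood_retract X.
Proof.
have [G [w [T [cG cvx]]]] := curvature_le_uniformly_convex hk.
exact: uniformly_convex_ANR hX cG cvx.
Qed.
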